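(* There is a constant $C$ such that every locally Gabriel graph on a convexly independent set of $n\ge2$ points in the plane has at most $2n\log_2 n + Cn$ edges.
   Context: A finite point set $P\subset\mathbb{R}^2$ is convexly independent if no point of $P$ lies in the convex hull of the other points. A geometric graph $G=(P,E)$ is a locally Gabriel graph (LGG) if for every edge $\{u,v\}\in E$, the closed disk having the segment $\overline{uv}$ as diameter contains no neighbor (in $G$) of $u$ or of $v$ other than $u,v$ themselves; equivalently, two edges $\{u,v\},\{u,w\}\in E$ sharing the endpoint $u$ can coexist only if $\angle uwv<\pi/2$ and $\angle uvw<\pi/2$. *)

(* Defs.v *)
From Stdlib Require Import Reals Lra.
Open Scope R_scope.

Definition point := (R * R)%type.

Fixpoint fsum (n : nat) (f : nat -> R) : R :=
  match n with O => 0 | S m => fsum m f + f m end.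

Fixpoint fcount (n : nat) (b : nat -> bool) : nat :=
  match n with O => O | S m => (fcount m b + (if b m then 1 else 0))%nat end.

Definition in_hull_others (n : nat) (p : nat -> point) (i : nat) (q : point) : Prop :=
  exists w : nat -> R,
    (forall j, (j < n)%nat -> 0 <= w j) /\
    w i = 0 /\
    fsum n w = 1 /\
    fsum n (fun j => w j * fst (p j)) = fst q /\
    fsum n (fun j => w j * snd (p j)) = snd q.

Definition convexly_independent (n : nat) (p : nat -> point) : Prop :=
  forall i, (i < n)%nat -> ~ in_hull_others n p i (p i).

Definition sqdist (a b : point) : R :=
  (fst a - fst b) ^ 2 + (snd a - snd b) ^ 2.

Definition in_diam_disk (u v w : point) : Prop :=
  sqdist w ((fst u + fst v) / 2, (snd u + snd v) / 2) <= sqdist u v / 4.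

Definition simple_graph (adj : nat -> nat -> bool) : Prop :=
  (forall i j, adj i j = adj j i) /\ (forall i, adj i i = false).

Definition locally_gabriel (n : nat) (p : nat -> point) (adj : nat -> nat -> bool) : Prop :=
  forall i j k, (i < n)%nat -> (j < n)%nat -> (k < n)%nat ->
    k <> i -> k <> j -> adj i j = true ->
    (adj i k = true \/ adj j k = true) ->
    ~ in_diam_disk (p i) (p j) (p k).

Fixpoint num_edges (n : nat) (adj : nat -> nat -> bool) : nat :=
  match n with
  | O => O
  | S m => (num_edges m adj + fcount m (fun i => adj i m))%nat
  end.

(* Main.v *)
Require Import Defs.
From Stdlib Require Import Reals Lra Lia Arith List Permutation Sorted Bool.
Import ListNotations.
Open Scope R_scope.

(** After a rotation no two points share an abscissa; split the points into the
    upper chain U and the lower chain L.  A relation with no "corner" (edges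
    [(a,b)], [(a,b')], [(a',b)] with [a < a'], [b < b']) is linear in size, as
    every edge is the last one of its row or of its column.  Inside a chain a
    corner would make an x-monotone convex path turn by more than pi, so only
    the edges between U and L matter.  There, a corner forces the chords [aa']
    and [bb'] to converge in the direction of the corner.  Give every vertex the
    slope of a supporting line of its chain and cut the list of all vertices,
    sorted by slope, into two halves: between the U-vertices of one half and the
    L-vertices of the other, chords can converge in one direction only, so these
    edges are linear in number.  The recursion T(n) = 2 T(n/2) + O(n) concludes. *)

(** * Counting pairs *)

Definition count (f : nat -> bool) (l : list nat) : nat := length (filter f l).

Definition cnt (E : nat -> nat -> bool) (A B : list nat) : nat :=
  list_sum (map (fun a => count (E a) B) A).

Lemma count_cons f x l : count f (x :: l) = ((if f x then 1 else 0) + count f l)%nat.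
Proof. unfold count; simpl; destruct (f x); reflexivity. Qed.

Lemma count_app f l l' : count f (l ++ l') = (count f l + count f l')%nat.
Proof. unfold count; rewrite filter_app, length_app; reflexivity. Qed.

Lemma cnt_cons E a A B : cnt E (a :: A) B = (count (E a) B + cnt E A B)%nat.
Proof. reflexivity. Qed.

Lemma cnt_app_l E A A' B : cnt E (A ++ A') B = (cnt E A B + cnt E A' B)%nat.
Proof. unfold cnt; rewrite map_app, list_sum_app; reflexivity. Qed.

Lemma cnt_nil_r E A : cnt E A [] = 0%nat.
Proof. induction A; [ reflexivity | rewrite cnt_cons, IHA; reflexivity ]. Qed.

Lemma cnt_cons_r E A b B :
  cnt E A (b :: B) = (count (fun a => E a b) A + cnt E A B)%nat.
Proof.
  induction A as [|a A IH]; [ reflexivity |].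
  rewrite !cnt_cons, IH, !count_cons; lia.
Qed.

Lemma cnt_flip E A B : cnt E A B = cnt (fun b a => E a b) B A.
Proof.
  induction B as [|b B IH]; [ apply cnt_nil_r |].
  rewrite cnt_cons_r, cnt_cons, IH; reflexivity.
Qed.

Lemma cnt_app_r E A B B' : cnt E A (B ++ B') = (cnt E A B + cnt E A B')%nat.
Proof. rewrite !(cnt_flip E A); apply cnt_app_l. Qed.

Lemma count_perm f l l' : Permutation l l' -> count f l = count f l'.
Proof. induction 1; rewrite ?count_cons; lia. Qed.

Lemma cnt_perm E A A' B B' :
  Permutation A A' -> Permutation B B' -> cnt E A B = cnt E A' B'.
Proof.
  intros HA HB; transitivity (cnt E A' B).
  - clear HB; induction HA; rewrite ?cnt_cons; lia.
  - rewrite !(cnt_flip E A'); clear HA; induction HB; rewrite ?cnt_cons; lia.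
Qed.

Lemma count_le_orb f g h l :
  (forall x, In x l -> f x = true -> g x || h x = true) ->
  (count f l <= count g l + count h l)%nat.
Proof.
  induction l as [|x l IH]; intros H; [ reflexivity |].
  rewrite !count_cons.
  assert (Hl := IH (fun y Hy => H y (or_intror Hy))).
  assert (Hx := H x (or_introl eq_refl)).
  destruct (f x), (g x), (h x); simpl in *; lia.
Qed.

Lemma cnt_le_orb E F G A B :
  (forall a b, In a A -> In b B -> E a b = true -> F a b || G a b = true) ->
  (cnt E A B <= cnt F A B + cnt G A B)%nat.
Proof.
  induction A as [|a A IH]; intros H; [ reflexivity |].
  rewrite !cnt_cons.
  assert (H1 := IH (fun x b Hx Hb => H x b (or_intror Hx) Hb)).
  assert (H2 := count_le_orb (E a) (F a) (G a) B
                  (fun b Hb => H a b (or_introl eq_refl) Hb)).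
  lia.
Qed.

Lemma count_unique f l :
  NoDup l ->
  (forall x y, In x l -> In y l -> f x = true -> f y = true -> x = y) ->
  (count f l <= 1)%nat.
Proof.
  intros Hnd H; unfold count.
  assert (Hf : NoDup (filter f l)) by now apply NoDup_filter.
  destruct (filter f l) as [|x [|y m]] eqn:Hm; simpl; try lia.
  assert (Hx : In x (filter f l)) by (rewrite Hm; simpl; tauto).
  assert (Hy : In y (filter f l)) by (rewrite Hm; simpl; tauto).
  apply filter_In in Hx; apply filter_In in Hy.
  inversion Hf as [|? ? Hnin]; subst; elim Hnin.
  left; symmetry; apply H; tauto.
Qed.

Lemma cnt_rows_unique E A B :
  NoDup B ->
  (forall a x y, In a A -> In x B -> In y B -> E a x = true -> E a y = true -> x = y) ->
  (cnt E A B <= length A)%nat.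
Proof.
  intros HB; induction A as [|a A IH]; intros H; [ reflexivity |].
  rewrite cnt_cons; simpl length.
  assert (H1 := IH (fun a' x y Ha => H a' x y (or_intror Ha))).
  assert (H2 := count_unique (E a) B HB (fun x y => H a x y (or_introl eq_refl))).
  lia.
Qed.

(** * Relations without corners *)

Definition Rltb (x y : R) : bool := if Rlt_dec x y then true else false.

Lemma Rltb_true x y : Rltb x y = true <-> x < y.
Proof. unfold Rltb; destruct (Rlt_dec x y); split; intros; try easy; lra. Qed.

Definition inj_on (f : nat -> R) (A : list nat) : Prop :=
  forall x y, In x A -> In y A -> f x = f y -> x = y.

(** Applied to the flipped relation, the same definition gives the last entry of a column. *)
Definition last_in_row (E : nat -> nat -> bool) (g : nat -> R) (B : list nat)
    (a b : nat) : bool :=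
  E a b && forallb (fun b' => negb (E a b' && Rltb (g b) (g b'))) B.

Lemma last_in_row_unique E g B a x y :
  inj_on g B -> In x B -> In y B ->
  last_in_row E g B a x = true -> last_in_row E g B a y = true -> x = y.
Proof.
  unfold last_in_row; intros Hg Hx Hy Lx Ly.
  apply andb_true_iff in Lx as [Ex Lx]; apply andb_true_iff in Ly as [Ey Ly].
  rewrite forallb_forall in Lx, Ly.
  specialize (Lx y Hy); specialize (Ly x Hx).
  rewrite Ey in Lx; rewrite Ex in Ly; unfold Rltb in *; simpl in *.
  apply Hg; trivial.
  destruct (Rlt_dec (g x) (g y)), (Rlt_dec (g y) (g x)); try discriminate; lra.
Qed.

Lemma not_last_in_row E g B a b :
  E a b = true -> last_in_row E g B a b = false ->
  exists b', In b' B /\ E a b' = true /\ g b < g b'.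
Proof.
  unfold last_in_row; intros Eab H; rewrite Eab in H; simpl in H.
  assert (He : existsb (fun b' => E a b' && Rltb (g b) (g b')) B = true).
  { clear Eab; induction B as [|c B IH]; simpl in *; [ discriminate |].
    destruct (E a c && Rltb (g b) (g c)); simpl in *; auto. }
  apply existsb_exists in He as [b' [Hb' He]].
  apply andb_true_iff in He as [He Hlt]; apply Rltb_true in Hlt; eauto.
Qed.

(** A pair that is last neither in its row nor in its column has a later pair in both, hence is the
    apex of a corner. So row-last and column-last pairs cover [E], with at most one per element of
    [A] and of [B]. The orders [f] and [g] are parameters so that corners of every orientation can
    be treated. *)
Lemma cnt_no_corner E (f g : nat -> R) A B :
  NoDup A -> NoDup B -> inj_on f A -> inj_on g B ->
  (forall a a' b b', In a A -> In a' A -> In b B -> In b' B ->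
     E a b = true -> E a b' = true -> E a' b = true ->
     f a < f a' -> g b < g b' -> False) ->
  (cnt E A B <= length A + length B)%nat.
Proof.
  intros NA NB Hf Hg H.
  set (Et := fun b a => E a b).
  assert (H1 : (cnt E A B <= cnt (last_in_row E g B) A B
                 + cnt (fun a b => last_in_row Et f A b a) A B)%nat).
  { apply cnt_le_orb; intros a b Ha Hb Eab.
    destruct (last_in_row E g B a b) eqn:L1; trivial.
    destruct (last_in_row Et f A b a) eqn:L2; trivial.
    apply not_last_in_row in L1 as [b' [? [? ?]]]; trivial.
    apply not_last_in_row in L2 as [a' [? [? ?]]]; trivial.
    exfalso; eapply (H a a' b b'); eauto. }
  assert (H2 : (cnt (last_in_row E g B) A B <= length A)%nat).
  { apply cnt_rows_unique; trivial.
    intros a x y _; apply last_in_row_unique; trivial. }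
  assert (H3 : (cnt (last_in_row Et f A) B A <= length B)%nat).
  { apply cnt_rows_unique; trivial.
    intros a x y _; apply last_in_row_unique; trivial. }
  rewrite (cnt_flip (fun a b => last_in_row Et f A b a)) in H1.
  change (cnt (fun b a => last_in_row Et f A b a) B A)
    with (cnt (last_in_row Et f A) B A) in H1.
  lia.
Qed.

(** * From graph edges to ordered pairs *)

Lemma fcount_count n b : fcount n b = count b (seq 0 n).
Proof.
  induction n as [|n IH]; [ reflexivity |].
  rewrite seq_S, count_app, <- IH; simpl; unfold count; simpl.
  destruct (b n); reflexivity.
Qed.

Lemma num_edges_le_cnt n adj G :
  (forall i j, (i < j < n)%nat -> adj i j = true -> G i j || G j i = true) ->
  (num_edges n adj <= cnt G (seq 0 n) (seq 0 n))%nat.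
Proof.
  induction n as [|n IH]; intros H; [ reflexivity |].
  simpl num_edges; rewrite seq_S, cnt_app_l, !cnt_app_r; simpl (0 + n)%nat.
  rewrite (cnt_cons_r _ (seq 0 n)), cnt_nil_r, (cnt_cons _ n [] (seq 0 n)), fcount_count.
  assert (H1 := IH (fun i j Hij => H i j ltac:(lia))).
  assert (H2 : (count (fun i => adj i n) (seq 0 n) <=
                count (fun a => G a n) (seq 0 n) + count (G n) (seq 0 n))%nat).
  { apply count_le_orb; intros i Hi; apply in_seq in Hi; apply H; lia. }
  lia.
Qed.

(** * Divide and conquer along a sorted list *)

Lemma exists_sorted_perm (s : nat -> R) (l : list nat) :
  exists l', Permutation l l' /\ StronglySorted (fun i j => s i <= s j) l'.
Proof.
  assert (Hins : forall x l, StronglySorted (fun i j => s i <= s j) l ->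
    exists l', Permutation (x :: l) l' /\ StronglySorted (fun i j => s i <= s j) l').
  { intros x m; induction m as [|y m IH]; intros Hs.
    - exists [x]; split; [ reflexivity | repeat constructor ].
    - inversion Hs as [|? ? Hm Hy]; subst.
      destruct (Rle_dec (s x) (s y)) as [Hxy|Hxy].
      + exists (x :: y :: m); split; [ reflexivity |].
        constructor; trivial; constructor; trivial.
        eapply Forall_impl; [| exact Hy ]; simpl; intros; lra.
      + destruct (IH Hm) as [m' [Hp Hm']].
        exists (y :: m'); split.
        * rewrite perm_swap; constructor; trivial.
        * constructor; trivial.
          eapply Permutation_Forall; [ exact Hp |].
          constructor; trivial; lra. }
  induction l as [|x l [l' [Hp Hs]]].
  - exists []; split; [ reflexivity | constructor ].
  - destruct (Hins x l' Hs) as [m [Hm Hms]].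
    exists m; split; trivial; rewrite Hp; trivial.
Qed.

Lemma StronglySorted_app_inv (T : Type) (r : T -> T -> Prop) l l' :
  StronglySorted r (l ++ l') ->
  StronglySorted r l /\ StronglySorted r l' /\
  forall x y, In x l -> In y l' -> r x y.
Proof.
  induction l as [|a l IH]; simpl; intros H.
  - repeat split; trivial; [ constructor | tauto ].
  - inversion H as [|? ? Hl Ha]; subst.
    apply Forall_app in Ha as [Ha Ha'].
    destruct (IH Hl) as [H1 [H2 H3]]; repeat split; trivial.
    + constructor; trivial.
    + intros x y [<-|Hx] Hy; auto.
      rewrite Forall_forall in Ha'; auto.
Qed.

(** Each level adds the pairs between the two parts, in both orders since [E] need not be symmetric:
    at most [2 * length C] per level, over [k] levels. Irreflexivity settles singletons. *)
Lemma cnt_divide_and_conquer E (s : nat -> R) (V : list nat) :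
  (forall a, E a a = false) ->
  (forall C D, NoDup C -> NoDup D -> incl C V -> incl D V ->
     (forall x y, In x C -> In y D -> s x <= s y) ->
     (cnt E C D <= length C + length D)%nat /\
     (cnt E D C <= length C + length D)%nat) ->
  forall k C, NoDup C -> incl C V -> StronglySorted (fun i j => s i <= s j) C ->
    (length C <= 2 ^ k)%nat -> (cnt E C C <= 2 * k * length C)%nat.
Proof.
  intros Hirr Hcross; induction k as [|k IH]; intros C NC IC SC LC.
  - destruct C as [|c [|c' C]]; simpl in LC; try lia; [ reflexivity |].
    unfold cnt, count; simpl; rewrite Hirr; reflexivity.
  (* Cutting at [2 ^ k] instead of the middle keeps both parts within the induction hypothesis; the
     second one may be empty. *)
  - set (C1 := firstn (2 ^ k) C); set (C2 := skipn (2 ^ k) C).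
    assert (HC : C = C1 ++ C2) by (symmetry; apply firstn_skipn).
    assert (L1 : (length C1 <= 2 ^ k)%nat) by apply firstn_le_length.
    assert (L2 : (length C2 <= 2 ^ k)%nat).
    { unfold C2; rewrite length_skipn; simpl in LC; lia. }
    clearbody C1 C2; subst C.
    apply StronglySorted_app_inv in SC as [S1 [S2 S12]].
    apply incl_app_inv in IC as [I1 I2].
    assert (N1 := NoDup_app_remove_r _ _ NC).
    assert (N2 := NoDup_app_remove_l _ _ NC).
    destruct (Hcross C1 C2) as [K12 K21]; trivial.
    assert (K1 := IH C1 N1 I1 S1 L1); assert (K2 := IH C2 N2 I2 S2 L2).
    rewrite cnt_app_l, !cnt_app_r, length_app; lia.
Qed.

(** * Convex position *)

Lemma exists_leftmost (X : nat -> R) m : (1 <= m)%nat ->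
  exists l, (l < m)%nat /\ forall i, (i < m)%nat -> X l <= X i.
Proof.
  induction m as [|[|m] IH]; intros Hm; [ lia | |].
  - exists 0%nat; split; [ lia |]; intros i Hi; replace i with 0%nat by lia; lra.
  - destruct IH as [l [Hl Hmin]]; [ lia |].
    destruct (Rle_dec (X l) (X (S m))) as [H|H].
    + exists l; split; [ lia |]; intros i Hi.
      destruct (Nat.eq_dec i (S m)) as [->|]; trivial; apply Hmin; lia.
    + exists (S m); split; [ lia |]; intros i Hi.
      destruct (Nat.eq_dec i (S m)) as [->|]; [ lra |].
      assert (X l <= X i) by (apply Hmin; lia); lra.
Qed.

(** Measured counterclockwise from [d], the vector [e] has an angle in (0, pi/2) and [f] one in
    (pi/2, pi), so [f] is reached from [e] by a left turn of less than pi. *)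
Lemma cross_pos_of_acute_obtuse ex ey fx fy dx dy :
  0 < ex * dx + ey * dy -> fx * dx + fy * dy < 0 ->
  ex * dy - ey * dx < 0 -> fx * dy - fy * dx < 0 ->
  0 < ex * fy - ey * fx.
Proof.
  intros H1 H2 H3 H4.
  assert (Hd : 0 < dx * dx + dy * dy).
  { assert (dx <> 0 \/ dy <> 0) as [?|?]; [| nra | nra ].
    destruct (Req_dec dx 0); [ right; intros ->; subst; lra | now left ]. }
  (* The formula for the sine of a difference of two angles, scaled by the lengths. *)
  assert (Hid : (ex * fy - ey * fx) * (dx * dx + dy * dy) =
    (ex * dx + ey * dy) * - (fx * dy - fy * dx)
    + (ex * dy - ey * dx) * (fx * dx + fy * dy)) by ring.
  assert (0 < (ex * dx + ey * dy) * - (fx * dy - fy * dx)) by nra.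
  assert (0 < (ex * dy - ey * dx) * (fx * dx + fy * dy)) by nra.
  nra.
Qed.

(* Two right turns of more than pi/2 leave the half plane [x > 0]. *)
Lemma no_two_sharp_turns x1 y1 x2 y2 x3 y3 :
  0 < x1 -> 0 < x2 -> 0 < x3 ->
  x1 * x2 + y1 * y2 < 0 -> x2 * x3 + y2 * y3 < 0 ->
  x1 * y2 - y1 * x2 < 0 -> x2 * y3 - y2 * x3 < 0 -> False.
Proof.
  intros P1 P2 P3 D12 D23 C12 C23.
  assert (0 < x1 * x2) by nra; assert (0 < x2 * x3) by nra.
  (* An obtuse turn between vectors pointing right reverses the sign of the ordinate. If [y2 < 0]
     the second turn goes upward, if [y2 > 0] the first one does, and such a turn is to the left. *)
  destruct (Rtotal_order y2 0) as [Hy|[Hy|Hy]]; [| subst; lra |].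
  - assert (0 < y3) by nra; nra.
  - assert (y1 < 0) by nra; nra.
Qed.

(** Stated with a [sig] type so that slopes chosen vertex by vertex can be assembled into a function
    without the axiom of choice. With [As] empty it provides an upper bound of [Bs]. *)
Lemma real_list_separation (As Bs : list R) :
  (forall a b, In a As -> In b Bs -> b <= a) ->
  {t : R | (forall a, In a As -> t <= a) /\ (forall b, In b Bs -> b <= t)}.
Proof.
  induction As as [|a As IH]; intros H.
  - clear H; induction Bs as [|b Bs [t [_ Ht]]].
    + exists 0; split; intros ? [].
    + exists (Rmax b t); split; [ intros ? [] |].
      intros c [<-|Hc]; [ apply Rmax_l |].
      eapply Rle_trans; [ apply Ht, Hc | apply Rmax_r ].
  - destruct IH as [t [H1 H2]]; [ intros; apply H; simpl; tauto |].
    exists (Rmin a t); split.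
    + intros c [<-|Hc]; [ apply Rmin_l |].
      eapply Rle_trans; [ apply Rmin_r | apply H1, Hc ].
    + intros b Hb; apply Rmin_glb; auto; apply H; simpl; tauto.
Qed.

(* [W] is the set of vertices of a concave chain; the chord condition says that
   slopes decrease. *)
Lemma exists_support_slope (X Y : nat -> R) (W : list nat) (a : nat) :
  (forall i, In i W -> X i = X a -> i = a) ->
  (forall i j, In i W -> In j W -> X i < X a -> X a < X j ->
     (Y j - Y a) * (X a - X i) <= (Y a - Y i) * (X j - X a)) ->
  {t : R | forall i, In i W -> Y i - Y a <= t * (X i - X a)}.
Proof.
  intros Hinj Hconc.
  set (sl := fun i => (Y i - Y a) / (X i - X a)).
  (* By concavity the chords from [a] to the left are at least as steep as those to the right; any
     slope separating the two families supports the chain at [a]. *)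
  destruct (real_list_separation
      (map sl (filter (fun i => Rltb (X i) (X a)) W))
      (map sl (filter (fun i => Rltb (X a) (X i)) W))) as [t [H1 H2]].
  - intros u v Hu Hv.
    apply in_map_iff in Hu as [i [<- Hi]]; apply in_map_iff in Hv as [j [<- Hj]].
    apply filter_In in Hi as [Hi Li]; apply filter_In in Hj as [Hj Lj].
    apply Rltb_true in Li; apply Rltb_true in Lj.
    assert (Hc := Hconc i j Hi Hj Li Lj); unfold sl.
    apply (Rmult_le_reg_r ((X j - X a) * (X a - X i))); [ nra |].
    replace ((Y j - Y a) / (X j - X a) * ((X j - X a) * (X a - X i)))
      with ((Y j - Y a) * (X a - X i)) by (field; lra).
    replace ((Y i - Y a) / (X i - X a) * ((X j - X a) * (X a - X i)))
      with ((Y a - Y i) * (X j - X a)) by (field; lra).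
    lra.
  - exists t; intros i Hi.
    assert (Hsl : X i <> X a -> Y i - Y a = sl i * (X i - X a))
      by (intros; unfold sl; field; lra).
    destruct (Rtotal_order (X i) (X a)) as [H|[H|H]].
    + assert (t <= sl i).
      { apply H1, in_map, filter_In; split; trivial; now apply Rltb_true. }
      rewrite Hsl by lra; nra.
    + rewrite (Hinj i Hi H); lra.
    + assert (sl i <= t).
      { apply H2, in_map, filter_In; split; trivial; now apply Rltb_true. }
      rewrite Hsl by lra; nra.
Qed.

Section ConvexPosition.

Variables (n : nat) (X Y : nat -> R) (adj : nat -> nat -> bool).

(** Positive iff the angle at the middle vertex [j] is acute. *)
Definition dot (i j k : nat) : R :=
  (X i - X j) * (X k - X j) + (Y i - Y j) * (Y k - Y j).

(* Positive iff [k] lies above the line [ij], when [X i < X j]. *)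
Definition orient (i j k : nat) : R :=
  (X j - X i) * (Y k - Y i) - (Y j - Y i) * (X k - X i).

Hypothesis X_inj : forall i j, (i < n)%nat -> (j < n)%nat -> X i = X j -> i = j.
Hypothesis adj_sym : forall i j, adj i j = adj j i.
Hypothesis adj_acute : forall i j k, (i < n)%nat -> (j < n)%nat -> (k < n)%nat ->
  j <> k -> adj i j = true -> adj i k = true -> 0 < dot i j k.
(** The only form in which convex independence enters: a point on or above one chord and on or below
    another lies in the hull of their endpoints, which may coincide. *)
Hypothesis no_point_between_chords : forall q u v w z,
  (q < n)%nat -> (u < n)%nat -> (v < n)%nat -> (w < n)%nat -> (z < n)%nat ->
  X u < X q < X v -> X w < X q < X z ->
  0 <= orient u v q -> orient w z q <= 0 -> False.

(** * Upper and lower chains *)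

Variables l r : nat.
Hypothesis l_lt : (l < n)%nat.
Hypothesis r_lt : (r < n)%nat.
Hypothesis l_min : forall i, (i < n)%nat -> X l <= X i.
Hypothesis r_max : forall i, (i < n)%nat -> X i <= X r.

(** Points on the line [lr] count as upper, in particular [l] and [r] themselves; lower points are
    strictly below it. *)
Definition upper (i : nat) : bool := negb (Rltb (orient l r i) 0).

Lemma upper_true i : upper i = true -> 0 <= orient l r i.
Proof. unfold upper, Rltb; destruct (Rlt_dec _ _); [ discriminate | lra ]. Qed.

Lemma upper_false i : upper i = false -> orient l r i < 0.
Proof. unfold upper, Rltb; destruct (Rlt_dec _ _); [ trivial | discriminate ]. Qed.

(** The abscissa conditions come from the extremality of [l] and [r]. For the others, [orient] is an
    alternating signed area, so permuting its arguments changes at most its sign. *)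
Ltac between q u v w z :=
  exfalso; apply (no_point_between_chords q u v w z); trivial;
  try (split; repeat match goal with H : (?i < n)%nat |- _ =>
         generalize (l_min i H), (r_max i H); clear H end; lra);
  unfold orient in *; lra.

Lemma upper_chord_below a b c :
  (a < n)%nat -> (b < n)%nat -> (c < n)%nat ->
  upper b = true -> X a < X b < X c -> 0 < orient a c b.
Proof.
  intros Ha Hb Hc Ub Hx; apply upper_true in Ub.
  destruct (Rlt_dec 0 (orient a c b)); trivial.
  between b l r a c.
Qed.

Lemma lower_chord_above a b c :
  (a < n)%nat -> (b < n)%nat -> (c < n)%nat ->
  upper b = false -> X a < X b < X c -> orient a c b < 0.
Proof.
  intros Ha Hb Hc Ub Hx; apply upper_false in Ub.
  destruct (Rlt_dec (orient a c b) 0); trivial.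
  between b a c l r.
Qed.

(** This concerns the whole line [aa'], as [b] may lie beyond the chord. If [b] were on or above the
    line, the middle one of the three points in the order of abscissas would be caught between two
    chords. *)
Lemma lower_below_upper_chord a a' b :
  (a < n)%nat -> (a' < n)%nat -> (b < n)%nat ->
  upper a = true -> upper a' = true -> upper b = false ->
  X a < X a' -> orient a a' b < 0.
Proof.
  intros Ha Ha' Hb Ua Ua' Ub Hx.
  destruct (Rlt_dec (orient a a' b) 0); trivial.
  assert (X b <> X a) by (intros E; apply X_inj in E; trivial; congruence).
  assert (X b <> X a') by (intros E; apply X_inj in E; trivial; congruence).
  apply upper_true in Ua, Ua'; apply upper_false in Ub.
  destruct (Rlt_dec (X b) (X a)); [ between a l r b a' |].
  destruct (Rlt_dec (X b) (X a')); [ between b a a' l r |].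
  between a' l r a b.
Qed.

Lemma upper_above_lower_chord b b' a :
  (b < n)%nat -> (b' < n)%nat -> (a < n)%nat ->
  upper b = false -> upper b' = false -> upper a = true ->
  X b < X b' -> 0 < orient b b' a.
Proof.
  intros Hb Hb' Ha Ub Ub' Ua Hx.
  destruct (Rlt_dec 0 (orient b b' a)); trivial.
  assert (X a <> X b) by (intros E; apply X_inj in E; trivial; congruence).
  assert (X a <> X b') by (intros E; apply X_inj in E; trivial; congruence).
  apply upper_false in Ub, Ub'; apply upper_true in Ua.
  destruct (Rlt_dec (X a) (X b)); [ between b a b' l r |].
  destruct (Rlt_dec (X a) (X b')); [ between a l r b b' |].
  between b' b a l r.
Qed.

(** The edges at [b] make the angle at [a] acute and those at [a] make the angle at [b] acute, so
    [aa'], [bb'] and [ab] play the roles of [e], [f] and [d] in [cross_pos_of_acute_obtuse]. The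
    conclusion says that [bb'] has the larger slope: the chords converge to the right. *)
Lemma forward_corner_converges a a' b b' :
  (a < n)%nat -> (a' < n)%nat -> (b < n)%nat -> (b' < n)%nat ->
  upper a = true -> upper a' = true -> upper b = false -> upper b' = false ->
  X a < X a' -> X b < X b' ->
  adj a b = true -> adj a b' = true -> adj a' b = true ->
  0 < (X a' - X a) * (Y b' - Y b) - (Y a' - Y a) * (X b' - X b).
Proof.
  intros Ha Ha' Hb Hb' Ua Ua' Ub Ub' Hxa Hxb E1 E2 E3.
  assert (D1 : 0 < dot b a a').
  { apply adj_acute; rewrite 1?(adj_sym b); trivial; intros <-; lra. }
  assert (D2 : 0 < dot a b b') by (apply adj_acute; trivial; intros <-; lra).
  assert (O1 := lower_below_upper_chord a a' b Ha Ha' Hb Ua Ua' Ub Hxa).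
  assert (O2 := upper_above_lower_chord b b' a Hb Hb' Ha Ub Ub' Ua Hxb).
  unfold dot, orient in *.
  apply (cross_pos_of_acute_obtuse _ _ _ _ (X b - X a) (Y b - Y a)); lra.
Qed.

Lemma backward_corner_converges a a' b b' :
  (a < n)%nat -> (a' < n)%nat -> (b < n)%nat -> (b' < n)%nat ->
  upper a = true -> upper a' = true -> upper b = false -> upper b' = false ->
  X a < X a' -> X b < X b' ->
  adj a' b' = true -> adj a' b = true -> adj a b' = true ->
  (X a' - X a) * (Y b' - Y b) - (Y a' - Y a) * (X b' - X b) < 0.
Proof.
  intros Ha Ha' Hb Hb' Ua Ua' Ub Ub' Hxa Hxb E1 E2 E3.
  assert (D1 : 0 < dot b' a' a).
  { apply adj_acute; rewrite 1?(adj_sym b'); trivial; intros <-; lra. }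
  assert (D2 : 0 < dot a' b' b) by (apply adj_acute; trivial; intros <-; lra).
  assert (O1 := lower_below_upper_chord a a' b' Ha Ha' Hb' Ua Ua' Ub' Hxa).
  assert (O2 := upper_above_lower_chord b b' a' Hb Hb' Ha' Ub Ub' Ua' Hxb).
  unfold dot, orient in *.
  (* The vectors from [a'] to [a], from [b'] to [b] and from [a'] to [b'], with ordinates negated:
     the reflection restores the required orientation. *)
  assert (H := cross_pos_of_acute_obtuse (X a - X a') (Y a' - Y a) (X b - X b')
    (Y b' - Y b) (X b' - X a') (Y a' - Y b')).
  lra.
Qed.

(* Each pair inside a chain is listed from left to right. *)
Definition chain_edge (c : bool) (a b : nat) : bool :=
  adj a b && (Bool.eqb (upper a) c && Bool.eqb (upper b) c && Rltb (X a) (X b)).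

Definition cross_edge (a b : nat) : bool := adj a b && (upper a && negb (upper b)).

Lemma chain_edge_true c a b : chain_edge c a b = true ->
  adj a b = true /\ upper a = c /\ upper b = c /\ X a < X b.
Proof.
  unfold chain_edge; rewrite !andb_true_iff, !eqb_true_iff, Rltb_true; tauto.
Qed.

Lemma cross_edge_true a b : cross_edge a b = true ->
  adj a b = true /\ upper a = true /\ upper b = false.
Proof. unfold cross_edge; rewrite !andb_true_iff, negb_true_iff; tauto. Qed.

(** * Counting edges within and between the chains *)

Lemma X_inj_on A : incl A (seq 0 n) -> inj_on X A.
Proof.
  intros HA x y Hx Hy; apply HA, in_seq in Hx; apply HA, in_seq in Hy.
  apply X_inj; lia.
Qed.

Lemma opp_X_inj_on A : incl A (seq 0 n) -> inj_on (fun i => - X i) A.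
Proof. intros HA x y Hx Hy E; apply (X_inj_on A HA); trivial; lra. Qed.

(** Left endpoints are ordered by [- X], so a corner reads [a'], [a], [b], [b'] from left to right.
    The angles at [a] and [b] are acute, so this path turns by more than pi/2 at both, each time in
    the same direction by convexity. *)
Lemma cnt_chain_edge c :
  (cnt (chain_edge c) (seq 0 n) (seq 0 n) <= 2 * n)%nat.
Proof.
  replace (2 * n)%nat with (length (seq 0 n) + length (seq 0 n))%nat
    by (rewrite length_seq; lia).
  apply (cnt_no_corner _ (fun i => - X i) X); try apply seq_NoDup.
  - apply opp_X_inj_on, incl_refl.
  - apply X_inj_on, incl_refl.
  - intros a a' b b' Ha Ha' Hb Hb' E1 E2 E3 Hfa Hgb.
    apply in_seq in Ha, Ha', Hb, Hb'.
    apply chain_edge_true in E1 as [E1 [Ua [Ub Hab]]].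
    apply chain_edge_true in E2 as [E2 [_ [Ub' _]]].
    apply chain_edge_true in E3 as [E3 [Ua' [_ _]]].
    assert (D1 : 0 < dot b a a').
    { apply adj_acute; rewrite 1?(adj_sym b); trivial; try lia; intros <-; lra. }
    assert (D2 : 0 < dot a b b')
      by (apply adj_acute; trivial; try lia; intros <-; lra).
    unfold dot in *; destruct c.
    + assert (O1 : 0 < orient a' b a) by (apply upper_chord_below; trivial; lia || lra).
      assert (O2 : 0 < orient a b' b) by (apply upper_chord_below; trivial; lia || lra).
      unfold orient in *.
      apply (no_two_sharp_turns (X a - X a') (Y a - Y a') (X b - X a) (Y b - Y a)
               (X b' - X b) (Y b' - Y b)); lra.
    (* On the lower chain the turns are to the left; negating ordinates makes them right turns. *)
    + assert (O1 : orient a' b a < 0) by (apply lower_chord_above; trivial; lia || lra).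
      assert (O2 : orient a b' b < 0) by (apply lower_chord_above; trivial; lia || lra).
      unfold orient in *.
      apply (no_two_sharp_turns (X a - X a') (Y a' - Y a) (X b - X a) (Y a - Y b)
               (X b' - X b) (Y b - Y b')); lra.
Qed.

Lemma exists_slope_function : exists s : nat -> R,
  (forall a i, (a < n)%nat -> (i < n)%nat -> upper a = true -> upper i = true ->
     Y i - Y a <= s a * (X i - X a)) /\
  (forall b i, (b < n)%nat -> (i < n)%nat -> upper b = false -> upper i = false ->
     s b * (X i - X b) <= Y i - Y b).
Proof.
  (* Only vertices of the same chain constrain the slope at [a]; indices outside the range get the
     default 0. *)
  assert (F : forall a, {t : R | (a < n)%nat -> forall i, (i < n)%nat ->
    upper i = upper a ->
    if upper a then Y i - Y a <= t * (X i - X a) else t * (X i - X a) <= Y i - Y a}).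
  { intros a; destruct (lt_dec a n) as [Ha|Ha]; [| now exists 0 ].
    set (W := filter (fun i => Bool.eqb (upper i) (upper a)) (seq 0 n)).
    assert (HW : forall i, In i W <-> (i < n)%nat /\ upper i = upper a).
    { intros i; unfold W; rewrite filter_In, in_seq, eqb_true_iff.
      split; intros [? ?]; split; trivial; lia. }
    destruct (upper a) eqn:Ua.
    - destruct (exists_support_slope X Y W a) as [t Ht].
      + intros i Hi; apply HW in Hi; apply X_inj; tauto.
      + intros i j Hi Hj Xi Xj; apply HW in Hi as [Hi _]; apply HW in Hj as [Hj _].
        assert (O : 0 < orient i j a) by (apply upper_chord_below; auto).
        unfold orient in O; lra.
      + exists t; intros _ i Hi Ui; apply Ht, HW; auto.
    (* The lower chain becomes concave under negation of ordinates, which also negates the slope. *)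
    - destruct (exists_support_slope X (fun i => - Y i) W a) as [t Ht].
      + intros i Hi; apply HW in Hi; apply X_inj; tauto.
      + intros i j Hi Hj Xi Xj; apply HW in Hi as [Hi _]; apply HW in Hj as [Hj _].
        assert (O : orient i j a < 0) by (apply lower_chord_above; auto).
        unfold orient in O; lra.
      + exists (- t); intros _ i Hi Ui.
        assert (H := Ht i (proj2 (HW i) (conj Hi Ui))); lra. }
  exists (fun a => proj1_sig (F a)); split; intros a i Ha Hi Ua Ui;
    destruct (F a) as [t Ht]; simpl; specialize (Ht Ha i Hi);
    rewrite Ua in Ht; auto.
Qed.

Lemma cnt_cross_edge k : (n <= 2 ^ k)%nat ->
  (cnt cross_edge (seq 0 n) (seq 0 n) <= 2 * k * n)%nat.
Proof.
  intros Hk.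
  destruct exists_slope_function as [s [SU SL]].
  destruct (exists_sorted_perm s (seq 0 n)) as [C [HC SC]].
  rewrite (cnt_perm _ _ _ _ _ HC HC).
  assert (LC : length C = n) by (rewrite <- (Permutation_length HC); apply length_seq).
  rewrite <- LC.
  apply (cnt_divide_and_conquer _ s (seq 0 n)); trivial.
  - intros a; unfold cross_edge; destruct (upper a); apply andb_false_r.
  - clear C HC SC LC; intros C D NC ND IC ID H; split.
    (* Upper slopes are at most lower ones here. Supporting lines at the left ends give slope of
       [aa'] <= [s a'] <= [s b'] <= slope of [bb'], so the chords cannot converge to the left and
       backward corners are excluded. *)
    + apply (cnt_no_corner _ (fun i => - X i) (fun i => - X i)); trivial;
        try (apply opp_X_inj_on; trivial).
      intros a a' b b' Ha Ha' Hb Hb' E1 E2 E3 Hfa Hgb.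
      assert (Hs := H a' b' Ha' Hb').
      apply IC, in_seq in Ha, Ha'; apply ID, in_seq in Hb, Hb'.
      apply cross_edge_true in E1 as [E1 [Ua Ub]].
      apply cross_edge_true in E2 as [E2 [_ Ub']].
      apply cross_edge_true in E3 as [E3 [Ua' _]].
      assert (K : (X a - X a') * (Y b - Y b') - (Y a - Y a') * (X b - X b') < 0)
        by (apply backward_corner_converges; trivial; lia || lra).
      assert (Ka := SU a' a ltac:(lia) ltac:(lia) Ua' Ua).
      assert (Kb := SL b' b ltac:(lia) ltac:(lia) Ub' Ub).
      assert (0 < X a - X a') by lra; assert (0 < X b - X b') by lra.
      assert (0 < (X a - X a') * (X b - X b')) by nra.
      nra.
    (* Now lower slopes are at most upper ones. Supporting lines at the right ends give slope of
       [bb'] <= [s b'] <= [s a'] <= slope of [aa'], which excludes forward corners. *)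
    + rewrite Nat.add_comm; apply (cnt_no_corner _ X X); trivial;
        try (apply X_inj_on; trivial).
      intros a a' b b' Ha Ha' Hb Hb' E1 E2 E3 Hfa Hgb.
      assert (Hs := H b' a' Hb' Ha').
      apply ID, in_seq in Ha, Ha'; apply IC, in_seq in Hb, Hb'.
      apply cross_edge_true in E1 as [E1 [Ua Ub]].
      apply cross_edge_true in E2 as [E2 [_ Ub']].
      apply cross_edge_true in E3 as [E3 [Ua' _]].
      assert (K : 0 < (X a' - X a) * (Y b' - Y b) - (Y a' - Y a) * (X b' - X b))
        by (apply forward_corner_converges; trivial; lia || lra).
      assert (Ka := SU a' a ltac:(lia) ltac:(lia) Ua' Ua).
      assert (Kb := SL b' b ltac:(lia) ltac:(lia) Ub' Ub).
      assert (0 < (X a' - X a) * (X b' - X b)) by nra.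
      nra.
  - apply (Permutation_NoDup HC), seq_NoDup.
  - intros x Hx; apply (Permutation_in _ (Permutation_sym HC)), Hx.
  - rewrite LC; trivial.
Qed.

Lemma num_edges_le k : (n <= 2 ^ k)%nat ->
  (num_edges n adj <= 2 * k * n + 4 * n)%nat.
Proof.
  intros Hk.
  set (G := fun a b => cross_edge a b || (chain_edge true a b || chain_edge false a b)).
  assert (H1 : (num_edges n adj <= cnt G (seq 0 n) (seq 0 n))%nat).
  { apply num_edges_le_cnt; intros i j Hij E.
    assert (X i <> X j) by (intros K; apply X_inj in K; lia).
    unfold G, cross_edge, chain_edge; rewrite (adj_sym j i), E; unfold Rltb.
    destruct (upper i), (upper j), (Rlt_dec (X i) (X j)), (Rlt_dec (X j) (X i));
      simpl; trivial; lra. }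
  assert (H2 := cnt_le_orb G cross_edge
    (fun a b => chain_edge true a b || chain_edge false a b)
    (seq 0 n) (seq 0 n) (fun _ _ _ _ h => h)).
  assert (H3 := cnt_le_orb (fun a b => chain_edge true a b || chain_edge false a b)
    (chain_edge true) (chain_edge false) (seq 0 n) (seq 0 n) (fun _ _ _ _ h => h)).
  assert (H4 := cnt_cross_edge k Hk).
  assert (H5 := cnt_chain_edge true); assert (H6 := cnt_chain_edge false).
  lia.
Qed.

End ConvexPosition.

(** * Reduction to distinct abscissas *)

Definition delta (u j : nat) : R := if Nat.eqb j u then 1 else 0.

Lemma delta_ge0 u j : 0 <= delta u j.
Proof. unfold delta; destruct (Nat.eqb j u); lra. Qed.

Lemma delta_neq u j : j <> u -> delta u j = 0.
Proof. unfold delta; intros H; destruct (Nat.eqb_spec j u); trivial; contradiction. Qed.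

Lemma fsum_ext m f g :
  (forall j, (j < m)%nat -> f j = g j) -> fsum m f = fsum m g.
Proof.
  induction m as [|m IH]; simpl; intros H; trivial.
  rewrite IH, (H m) by (intros; try apply H; lia); trivial.
Qed.

Lemma fsum_add m f g : fsum m (fun j => f j + g j) = fsum m f + fsum m g.
Proof. induction m as [|m IH]; simpl; [ lra | rewrite IH; lra ]. Qed.

Lemma fsum_delta m u c f : (u < m)%nat ->
  fsum m (fun j => c * delta u j * f j) = c * f u.
Proof.
  assert (Z : forall k, (k <= u)%nat -> fsum k (fun j => c * delta u j * f j) = 0).
  { induction k as [|k IH]; simpl; intros Hk; trivial.
    rewrite IH, delta_neq by lia; lra. }
  induction m as [|m IH]; simpl; intros Hu; [ lia |].
  destruct (Nat.eq_dec m u) as [->|Hne].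
  - rewrite Z by lia; unfold delta; rewrite Nat.eqb_refl; lra.
  - rewrite IH, delta_neq by lia; lra.
Qed.

(** A sum of point masses, so that weights add up correctly when some of the four indices
    coincide. *)
Definition weight4 (u v w z : nat) (cu cv cw cz : R) (j : nat) : R :=
  cu * delta u j + (cv * delta v j + (cw * delta w j + cz * delta z j)).

Lemma fsum_weight4 m u v w z cu cv cw cz f :
  (u < m)%nat -> (v < m)%nat -> (w < m)%nat -> (z < m)%nat ->
  fsum m (fun j => weight4 u v w z cu cv cw cz j * f j)
  = cu * f u + (cv * f v + (cw * f w + cz * f z)).
Proof.
  intros Hu Hv Hw Hz.
  rewrite <- (fsum_delta m u cu f), <- (fsum_delta m v cv f),
    <- (fsum_delta m w cw f), <- (fsum_delta m z cz f) by trivial.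
  rewrite <- !fsum_add; apply fsum_ext; intros j _; unfold weight4; ring.
Qed.

Lemma convexly_independent4 n p q u v w z cu cv cw cz :
  convexly_independent n p ->
  (q < n)%nat -> (u < n)%nat -> (v < n)%nat -> (w < n)%nat -> (z < n)%nat ->
  q <> u -> q <> v -> q <> w -> q <> z ->
  0 <= cu -> 0 <= cv -> 0 <= cw -> 0 <= cz -> cu + (cv + (cw + cz)) = 1 ->
  cu * fst (p u) + (cv * fst (p v) + (cw * fst (p w) + cz * fst (p z))) = fst (p q) ->
  cu * snd (p u) + (cv * snd (p v) + (cw * snd (p w) + cz * snd (p z))) = snd (p q) ->
  False.
Proof.
  intros Hci Hq Hu Hv Hw Hz Nu Nv Nw Nz Pu Pv Pw Pz Hsum Hfst Hsnd.
  apply (Hci q Hq); exists (weight4 u v w z cu cv cw cz); repeat split.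
  - intros j _; unfold weight4.
    generalize (delta_ge0 u j), (delta_ge0 v j), (delta_ge0 w j), (delta_ge0 z j).
    intros; repeat apply Rplus_le_le_0_compat; apply Rmult_le_pos; trivial.
  - unfold weight4; rewrite !delta_neq by trivial; lra.
  - rewrite <- Hsum.
    rewrite (fsum_ext _ _ (fun j => weight4 u v w z cu cv cw cz j * 1))
      by (intros; lra).
    rewrite (fsum_weight4 n u v w z cu cv cw cz (fun _ => 1)) by trivial; lra.
  - rewrite (fsum_weight4 n u v w z cu cv cw cz (fun j => fst (p j))) by trivial; trivial.
  - rewrite (fsum_weight4 n u v w z cu cv cw cz (fun j => snd (p j))) by trivial; trivial.
Qed.

Lemma Rdiv_in_unit x y : 0 <= x <= y -> 0 < y -> 0 <= x / y <= 1.
Proof.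
  intros Hx Hy; split; apply (Rmult_le_reg_r y); trivial;
    unfold Rdiv; rewrite Rmult_assoc, Rinv_l; lra.
Qed.

(** The last equation is [orient] vanishing at the point of the chord, ready to be compared with the
    orientation of another point of the same abscissa. *)
Lemma chord_point (xu yu xv yv x : R) : xu < x < xv ->
  exists c, 0 <= c <= 1 /\ c * xu + (1 - c) * xv = x /\
    (xv - xu) * (c * yu + (1 - c) * yv - yu) - (yv - yu) * (x - xu) = 0.
Proof.
  intros Hx; exists ((xv - x) / (xv - xu)).
  split; [ apply Rdiv_in_unit; lra | split; field; lra ].
Qed.

Lemma convex_combination_between (lo hi y : R) : lo <= y <= hi ->
  exists t, 0 <= t <= 1 /\ t * lo + (1 - t) * hi = y.
Proof.
  intros H; destruct (Req_dec lo hi) as [E|E].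
  - exists 1; lra.
  - exists ((hi - y) / (hi - lo)).
    split; [ apply Rdiv_in_unit; lra | field; lra ].
Qed.

(** * Geometric hypotheses after a rotation *)

Section Rotation.

Variables (n : nat) (p : nat -> point) (e : R).

(* Rotation and scaling: multiplication by [1 - e i] in the complex plane. *)
Definition rotX (i : nat) : R := fst (p i) + e * snd (p i).
Definition rotY (i : nat) : R := snd (p i) - e * fst (p i).

Lemma rot_dot i j k : dot rotX rotY i j k =
  (1 + e * e) * ((fst (p i) - fst (p j)) * (fst (p k) - fst (p j))
                 + (snd (p i) - snd (p j)) * (snd (p k) - snd (p j))).
Proof. unfold dot, rotX, rotY; ring. Qed.

(** Thales: [j] lies in the closed disk with diameter [ik] iff the inner product at [j] is at most
    0. The rotation only scales inner products by [1 + e * e]. *)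
Lemma rot_acute adj i j k :
  simple_graph adj -> locally_gabriel n p adj ->
  (i < n)%nat -> (j < n)%nat -> (k < n)%nat ->
  j <> k -> adj i j = true -> adj i k = true -> 0 < dot rotX rotY i j k.
Proof.
  intros [Hsym Hirr] Hlg Hi Hj Hk Hjk Eij Eik.
  assert (Hji : j <> i) by (intros ->; congruence).
  assert (H := Hlg i k j Hi Hk Hj Hji Hjk Eik (or_introl Eij)).
  unfold in_diam_disk, sqdist in H; simpl in H.
  rewrite rot_dot; apply Rmult_lt_0_compat; [ nra |].
  apply Rnot_le_lt; intros Hle; apply H; nra.
Qed.

Lemma rot_no_point_between_chords q u v w z :
  convexly_independent n p ->
  (q < n)%nat -> (u < n)%nat -> (v < n)%nat -> (w < n)%nat -> (z < n)%nat ->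
  rotX u < rotX q < rotX v -> rotX w < rotX q < rotX z ->
  0 <= orient rotX rotY u v q -> orient rotX rotY w z q <= 0 -> False.
Proof.
  intros Hci Hq Hu Hv Hw Hz Xuv Xwz O1 O2; unfold orient in *.
  destruct (chord_point (rotX u) (rotY u) (rotX v) (rotY v) (rotX q) Xuv)
    as [c [Pc [Xc Yc]]].
  destruct (chord_point (rotX w) (rotY w) (rotX z) (rotY z) (rotX q) Xwz)
    as [d [Pd [Xd Yd]]].
  (* [q] lies on the vertical segment joining its projections to the two chords; composing the three
     convex combinations gives the four weights. *)
  destruct (convex_combination_between (c * rotY u + (1 - c) * rotY v)
    (d * rotY w + (1 - d) * rotY z) (rotY q)) as [t [Pt Yt]]; [ split; nra |].
  assert (Xt : t * (c * rotX u + (1 - c) * rotX v)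
             + (1 - t) * (d * rotX w + (1 - d) * rotX z) = rotX q)
    by (rewrite Xc, Xd; ring).
  assert (fst_rot : forall i, fst (p i) = / (1 + e * e) * (rotX i - e * rotY i))
    by (intros i; unfold rotX, rotY; field; nra).
  assert (snd_rot : forall i, snd (p i) = / (1 + e * e) * (rotY i + e * rotX i))
    by (intros i; unfold rotX, rotY; field; nra).
  apply (convexly_independent4 n p q u v w z
    (t * c) (t * (1 - c)) ((1 - t) * d) ((1 - t) * (1 - d)));
    trivial; try (intros ->; lra); try (apply Rmult_le_pos; lra); [ ring | |].
  - rewrite !fst_rot, <- Xt, <- Yt; ring.
  - rewrite !snd_rot, <- Xt, <- Yt; ring.
Qed.

End Rotation.

Lemma exists_rotation_inj n (p : nat -> point) :
  (forall i j, (i < n)%nat -> (j < n)%nat -> p i = p j -> i = j) ->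
  exists e, forall i j, (i < n)%nat -> (j < n)%nat -> rotX p e i = rotX p e j -> i = j.
Proof.
  intros Hp.
  (* The one parameter that gives two points of different ordinates the same abscissa. Pairs of
     equal ordinates yield a meaningless value that only enlarges the finite list to be exceeded. *)
  set (bad := fun ij : nat * nat => let (i, j) := ij in
    (fst (p j) - fst (p i)) / (snd (p i) - snd (p j))).
  destruct (real_list_separation [] (map bad (list_prod (seq 0 n) (seq 0 n))))
    as [t [_ Ht]]; [ intros ? ? [] |].
  exists (t + 1); intros i j Hi Hj E; unfold rotX in E.
  assert (Hb : bad (i, j) <= t) by (apply Ht, in_map, in_prod; apply in_seq; lia).
  simpl in Hb.
  destruct (Req_dec (snd (p i)) (snd (p j))) as [Es|Es].
  - apply Hp; trivial; destruct (p i), (p j); simpl in *; subst; f_equal; lra.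
  - replace ((fst (p j) - fst (p i)) / (snd (p i) - snd (p j))) with (t + 1) in Hb.
    + lra.
    + apply (Rmult_eq_reg_r (snd (p i) - snd (p j))); [| lra ].
      field_simplify; lra.
Qed.

(** * Logarithms and the final bound *)

Lemma log2_up_le_log2 n : (2 <= n)%nat ->
  INR (Nat.log2_up n) <= ln (INR n) / ln 2 + 1.
Proof.
  intros Hn.
  destruct (Nat.log2_up_spec n) as [H _]; [ lia |].
  assert (Hpos := Nat.log2_up_pos n ltac:(lia)).
  (* As [n >= 2], the rounded logarithm is some [S k], and [2 ^ k < n]. *)
  destruct (Nat.log2_up n) as [|k]; [ lia |]; simpl Nat.pred in H.
  assert (L2 : 0 < ln 2) by (rewrite <- ln_1; apply ln_increasing; lra).
  apply lt_INR in H; rewrite pow_INR in H; simpl (INR 2) in H.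
  apply ln_increasing in H; [| apply pow_lt; lra ].
  replace (1 + 1) with 2 in H by lra.
  rewrite ln_pow, S_INR in * by lra.
  apply Rplus_le_compat_r, (Rmult_le_reg_r (ln 2)); trivial.
  unfold Rdiv; rewrite Rmult_assoc, Rinv_l; lra.
Qed.

Theorem theorem4p4 :
  exists C : R,
    forall (n : nat) (p : nat -> point) (adj : nat -> nat -> bool),
      (2 <= n)%nat ->
      (forall i j, (i < n)%nat -> (j < n)%nat -> p i = p j -> i = j) ->
      convexly_independent n p ->
      simple_graph adj ->
      locally_gabriel n p adj ->
      INR (num_edges n adj) <= 2 * INR n * (ln (INR n) / ln 2) + C * INR n.
Proof.
  (* 4 from the edges inside the two chains, and 2 from rounding the logarithm up in the factor
     [2 * k]. *)
  exists 6; intros n p adj Hn Hp Hci Hsg Hlg.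
  destruct (exists_rotation_inj n p Hp) as [e He].
  destruct (exists_leftmost (rotX p e) n) as [l [Hl Lmin]]; [ lia |].
  destruct (exists_leftmost (fun i => - rotX p e i) n) as [r [Hr Lmax]]; [ lia |].
  assert (H : (num_edges n adj <= 2 * Nat.log2_up n * n + 4 * n)%nat).
  { apply (num_edges_le n (rotX p e) (rotY p e) adj) with (l := l) (r := r); trivial.
    - apply Hsg.
    - intros i j k; apply rot_acute; trivial.
    - intros q u v w z; apply rot_no_point_between_chords; trivial.
    - intros i Hi; specialize (Lmax i Hi); simpl in Lmax; lra.
    - apply Nat.log2_up_spec; lia. }
  apply le_INR in H; rewrite plus_INR, !mult_INR in H; simpl (INR 2) in H.
  replace (INR 4) with 4 in H by (simpl; ring).
  assert (Hk := log2_up_le_log2 n Hn).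
  assert (Hpos := pos_INR n).
  nra.
Qed.
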